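(* Let $A_1=P_1J_1P_1^{-1}$ with $J_1=\mathrm{diag}(-p_1,-q_1)$, $0<p_1\le q_1$, and $A_2=P_2J_2P_2^{-1}$ with $J_2=\begin{pmatrix}n_2&1\\0&n_2\end{pmatrix}$, $n_2\ge0$; here $P_1,P_2$ are real invertible $2\times 2$ matrices chosen such that $M=P_2^{-1}P_1=\begin{pmatrix}a&b\\c&d\end{pmatrix}$ has determinant $1$ or $-1$. Given $\eta>0$, let $\tau_{2,1}(\eta)$ be the unique positive solution $t$ of $$n_2\eta+\ln\theta(\eta)=\left(\frac{p_1+q_1}{2}\right)t-\sinh^{-1}\left(\sqrt K\,\sinh\left(\frac{q_1-p_1}{2}\,t\right)\right),$$ where $K=\frac14\left(r^{-1}+r\right)^2$ with $r=\max\{2|cd|,1\}$. Then the switched system $\dot x(t)=A_{\sigma(t)}x(t)$ is stable for all $\sigma\in\mathcal S[\tau_{2,1}(\eta),\eta]$ and asymptotically stable for all $\sigma\in\mathcal S'[\tau_{2,1}(\eta),\eta]$.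
   Context: $\theta(t)=\left\|\begin{pmatrix}1&t\\0&1\end{pmatrix}\right\|=\sqrt{1+\frac{t^2}{2}+t\sqrt{1+\frac{t^2}{4}}}$ (spectral norm). Planar switched system: $\dot x(t)=A_{\sigma(t)}x(t)$, $x(t)\in\mathbb R^2$ continuous in $t\ge0$, with $A_1,A_2$ real $2\times2$ matrices. A switching signal $\sigma:[0,\infty)\to\{1,2\}$ is right-continuous and piecewise constant with infinitely many discontinuities $0<d_1<d_2<\cdots$, $d_k\to\infty$; set $d_0=0$. For a signal with $\sigma(0)=1$ put $t_k=d_{2k-1}-d_{2k-2}$ (times spent in $A_1$) and $s_k=d_{2k}-d_{2k-1}$ (times spent in $A_2$), $k\ge1$. For $\tau,\eta>0$, $\mathcal S[\tau,\eta]$ is the set of signals with $\sigma(0)=1$, $t_k\ge\tau$ and $s_k\le\eta$ for all $k\in\mathbb N$; $\mathcal S'[\tau,\eta]$ is the set of $\sigma\in\mathcal S[\tau,\eta]$ for which the sequence $(t_k,s_k)_{k\ge1}$ does not converge to $(\tau,\eta)$. For a given signal $\sigma$, the system is stable if for every $\varepsilon'>0$ there is $\delta>0$ such that $\|x(0)\|<\delta$ implies $\|x(t)\|<\varepsilon'$ for all $t>0$; it is asymptotically stable if it is stable and $\|x(t)\|\to0$ as $t\to\infty$ for every $x(0)\in\mathbb R^2$. Vector norms are Euclidean. *)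

(* Defs.v *)
From HB Require Import structures.
From mathcomp Require Import all_boot all_order all_algebra.
From mathcomp Require Import all_classical all_reals all_analysis.
From mathcomp Require Import ring lra.

Set Implicit Arguments.
Unset Strict Implicit.
Unset Printing Implicit Defensive.
Import Order.TTheory GRing.Theory Num.Theory.
Import numFieldNormedType.Exports.
Local Open Scope classical_set_scope.
Local Open Scope ring_scope.

(* The indices 0, 1 : 'I_2 stand for the first and second row or column. *)
Definition mx22 (R : realType) (a b c d : R) : 'M[R]_2 :=
  \matrix_(i, j) if i == 0 then (if j == 0 then a else b)
                 else (if j == 0 then c else d).

(* The library norm on matrices is the sup norm, hence this definition. *)
Definition enorm (R : realType) (v : 'cV[R]_2) : R :=
  Num.sqrt (\sum_i v i 0 ^+ 2).

Definition spectral_norm (R : realType) (A : 'M[R]_2) : R :=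
  sup [set enorm (A *m v) | v in [set v : 'cV[R]_2 | enorm v <= 1]].

Definition sinh (R : realType) (x : R) : R := (expR x - expR (- x)) / 2.

Definition arsinh (R : realType) (y : R) : R := ln (y + Num.sqrt (y ^+ 2 + 1)).

(* theta is the spectral norm itself; its closed form on [0, +oo[ is the lemma
   thetaE below. *)
Definition theta (R : realType) (t : R) : R := spectral_norm (mx22 1 t 0 1).

Inductive mode := mode1 | mode2.

(* sigma is a right-continuous piecewise constant signal on [0, +oo[ whose
   discontinuities are exactly d 1 < d 2 < ..., with d 0 = 0. The values of
   sigma at negative times play no role. *)
Definition switching_times (R : realType) (sigma : R -> mode) (d : nat -> R) :=
  [/\ d 0%N = 0,
      forall k, d k < d k.+1,
      d k @[k --> \oo] --> +oo,
      forall k s, d k <= s < d k.+1 -> sigma s = sigma (d k) &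
      forall k, sigma (d k.+1) <> sigma (d k)].

(* Indices are shifted by one: dwell1 d k and dwell2 d k are t_(k+1) and
   s_(k+1). *)
Definition dwell1 (R : realType) (d : nat -> R) (k : nat) : R :=
  d k.*2.+1 - d k.*2.
Definition dwell2 (R : realType) (d : nat -> R) (k : nat) : R :=
  d k.*2.+2 - d k.*2.+1.

Definition admissible (R : realType) (tau eta : R) (sigma : R -> mode)
    (d : nat -> R) :=
  [/\ switching_times sigma d, sigma 0 = mode1 &
      forall k, tau <= dwell1 d k /\ dwell2 d k <= eta].

Definition signalS (R : realType) (tau eta : R) : set (R -> mode) :=
  [set sigma | exists d, admissible tau eta sigma d].

Definition signalS' (R : realType) (tau eta : R) : set (R -> mode) :=
  [set sigma | exists2 d, admissible tau eta sigma d &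
     ~ ((dwell1 d k, dwell2 d k) @[k --> \oo] --> (tau, eta))].

Definition subsystem (R : realType) (A1 A2 : 'M[R]_2) (m : mode) : 'M[R]_2 :=
  match m with mode1 => A1 | mode2 => A2 end.

(* The equation is required at every t > 0 which is not a switching time, i.e.
   at which sigma is locally constant. *)
Definition switched_solution (R : realType) (A1 A2 : 'M[R]_2)
    (sigma : R -> mode) (x : R -> 'cV[R]_2) :=
  {within `[0, +oo[, continuous x} /\
  forall t : R, 0 < t -> (\forall s \near t, sigma s = sigma t) ->
    is_derive t (1 : R) x (subsystem A1 A2 (sigma t) *m x t).

Definition stable (R : realType) (A1 A2 : 'M[R]_2) (sigma : R -> mode) :=
  forall e : R, 0 < e -> exists2 delta : R, 0 < delta &
    forall x, switched_solution A1 A2 sigma x -> enorm (x 0) < delta ->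
      forall t : R, 0 < t -> enorm (x t) < e.

Definition asymptotically_stable (R : realType) (A1 A2 : 'M[R]_2)
    (sigma : R -> mode) :=
  stable A1 A2 sigma /\
  forall x, switched_solution A1 A2 sigma x -> enorm (x t) @[t --> +oo] --> 0.

Definition K21 (R : realType) (M : 'M[R]_2) : R :=
  let c := M 1 0 in let d := M 1 1 in
  let r := Num.max (2 * `|c * d|) 1 in
  (r^-1 + r) ^+ 2 / 4.

Definition tau21_equation (R : realType) (p1 q1 n2 K eta t : R) : Prop :=
  n2 * eta + ln (theta eta) =
  (p1 + q1) / 2 * t - arsinh (Num.sqrt K * sinh ((q1 - p1) / 2 * t)).

Section Facts.
Variable R : realType.
Implicit Types (x y t : R).

Lemma sinhK : cancel (@sinh R) (@arsinh R).
Proof.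
move=> x; rewrite /arsinh /sinh expRN.
have e0 := expR_gt0 x; set e := expR x in e0 *.
have -> : ((e - e^-1) / 2) ^+ 2 + 1 = ((e + e^-1) / 2) ^+ 2.
  by field; rewrite gt_eqF.
have ei : 0 < e^-1 by rewrite invr_gt0.
rewrite sqrtr_sqr ger0_norm; last by rewrite divr_ge0 // addr_ge0 ?ltW.
have -> : (e - e^-1) / 2 + (e + e^-1) / 2 = e by field; rewrite gt_eqF.
by rewrite expRK.
Qed.

Lemma arsinhK : cancel (@arsinh R) (@sinh R).
Proof.
move=> y; rewrite /arsinh /sinh expRN.
set s := Num.sqrt _.
have s2 : s ^+ 2 = y ^+ 2 + 1 by rewrite sqr_sqrtr // addr_ge0 ?sqr_ge0.
have s0 : 0 <= s by exact: sqrtr_ge0.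
have p : 0 < y + s.
  rewrite ltNge; apply/negP => h.
  have : s ^+ 2 <= y ^+ 2 by nra.
  by rewrite s2; lra.
rewrite lnK ?posrE //.
have -> : (y + s)^-1 = s - y.
  apply: (mulfI (lt0r_neq0 p)).
  by rewrite divff ?gt_eqF //; move: s2; nra.
by field.
Qed.

Lemma enormE (v : 'cV[R]_2) : enorm v = Num.sqrt (v 0 0 ^+ 2 + v 1 0 ^+ 2).
Proof.
by rewrite /enorm big_ord_recl big_ord1; congr (Num.sqrt (_ + v _ 0 ^+ 2)); apply/val_inj.
Qed.

Lemma shear_enorm t (v : 'cV[R]_2) : enorm (mx22 1 t 0 1 *m v) =
  Num.sqrt ((v 0 0 + t * v 1 0) ^+ 2 + v 1 0 ^+ 2).
Proof.
rewrite enormE !mxE !big_ord_recl !big_ord0 !mxE /= !addr0.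
have -> : lift ord0 ord0 = 1 :> 'I_2 by exact/val_inj.
by rewrite !mul1r mul0r add0r.
Qed.

Lemma thetaE t : 0 <= t ->
  theta t = Num.sqrt (1 + t ^+ 2 / 2 + t * Num.sqrt (1 + t ^+ 2 / 4)).
Proof.
move=> t0; set s := Num.sqrt (1 + t ^+ 2 / 4).
have s2 : s ^+ 2 = 1 + t ^+ 2 / 4.
  by rewrite sqr_sqrtr // addr_ge0 // divr_ge0 ?sqr_ge0.
have s0 : 0 <= s by exact: sqrtr_ge0.
set L := 1 + _ + _.
have L1 : 1 <= L.
  by rewrite /L; have : 0 <= t * s by [exact: mulr_ge0]; have := sqr_ge0 t; lra.
have LE : (L - 1) * (L - 1 - t ^+ 2) = t ^+ 2.
  have -> : L - 1 = t ^+ 2 / 2 + t * s by rewrite /L; ring.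
  have -> : (t ^+ 2 / 2 + t * s) * (t ^+ 2 / 2 + t * s - t ^+ 2)
    = t ^+ 2 * (s ^+ 2 - t ^+ 2 / 4) by field.
  by rewrite s2; ring.
have ub x y : (x + t * y) ^+ 2 + y ^+ 2 <= L * (x ^+ 2 + y ^+ 2).
  have [t0'|tn0] := eqVneq t 0.
    have -> : L = 1 by rewrite /L t0'; field.
    by rewrite t0' mul0r addr0 mul1r.
  have L1' : 0 < L - 1.
    have : 0 < t ^+ 2 by rewrite exprn_even_gt0.
    have : 0 <= t * s by exact: mulr_ge0.
    by rewrite /L; lra.
  rewrite -subr_ge0 -(pmulr_rge0 _ L1').
  have -> : (L - 1) * (L * (x ^+ 2 + y ^+ 2) - ((x + t * y) ^+ 2 + y ^+ 2)) =
    ((L - 1) * x - t * y) ^+ 2 + ((L - 1) * (L - 1 - t ^+ 2) - t ^+ 2) * y ^+ 2.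
    by ring.
  by rewrite LE subrr mul0r addr0 sqr_ge0.
have [v v1 vE] : exists2 v : 'cV[R]_2, enorm v <= 1 &
    enorm (mx22 1 t 0 1 *m v) = Num.sqrt L.
  have colE (x y : R) : let v := \col_(i < 2) (if i == 0 then x else y) in
      v 0 0 = x /\ v 1 0 = y by rewrite /= !mxE.
  have [t0'|tn0] := eqVneq t 0.
    exists (\col_(i < 2) (if i == 0 then 1 else 0)).
      by rewrite enormE !mxE /= expr1n expr0n addr0 sqrtr1.
    have -> : L = 1 by rewrite /L t0'; field.
    by rewrite shear_enorm !mxE /= mulr0 addr0 expr1n expr0n addr0.
  set N := t ^+ 2 + (L - 1) ^+ 2.
  have N0 : 0 < N by rewrite ltr_wpDr ?sqr_ge0 // exprn_even_gt0.
  have sN : Num.sqrt N ^+ 2 = N by rewrite sqr_sqrtr // ltW.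
  have sN0 : Num.sqrt N != 0 by rewrite gt_eqF // sqrtr_gt0.
  exists (\col_(i < 2) ((if i == 0 then t else L - 1) / Num.sqrt N)).
    by rewrite enormE !mxE /= !expr_div_n sN -mulrDl divff ?gt_eqF // sqrtr1.
  rewrite shear_enorm !mxE /=; congr Num.sqrt.
  rewrite mulrA -mulrDl !expr_div_n sN -mulrDl.
  apply: (mulIf (lt0r_neq0 N0)); rewrite mulfVK ?gt_eqF //.
  apply/eqP; rewrite -subr_eq0; apply/eqP.
  transitivity ((L - 1) * (t ^+ 2 - (L - 1) * (L - 1 - t ^+ 2))); last first.
    by rewrite LE subrr mulr0.
  by rewrite /N; ring.
have ubS : ubound [set enorm (mx22 1 t 0 1 *m v) | v in
    [set v : 'cV[R]_2 | enorm v <= 1]] (Num.sqrt L).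
  move=> _ [w /= w1 <-]; rewrite shear_enorm ler_wsqrtr //.
  apply: (le_trans (ub _ _)); rewrite ler_piMr //; first by lra.
  move: w1; rewrite enormE -[X in _ <= X]sqrtr1 ler_psqrt ?nnegrE //.
  by rewrite addr_ge0 ?sqr_ge0.
rewrite /theta /spectral_norm; apply/eqP; rewrite eq_le; apply/andP; split.
  by apply: (ge_sup _ ubS); exists (Num.sqrt L), v.
by apply: (ub_le_sup (ex_intro _ _ ubS)); exists v.
Qed.

End Facts.

(* Main.v *)
Require Import Defs.
From HB Require Import structures.
From mathcomp Require Import all_boot all_order all_algebra.
From mathcomp Require Import all_classical all_reals all_analysis.
From mathcomp Require Import ring lra.

Import Order.TTheory GRing.Theory Num.Theory.
Import numFieldNormedType.Exports.
Local Open Scope classical_set_scope.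
Local Open Scope ring_scope.

Set Implicit Arguments.
Unset Strict Implicit.
Unset Printing Implicit Defensive.

(** The coordinates y = S P2^-1 x, with S = ((1, xi), (0, 1)), leave the second
subsystem in Jordan form, because S commutes with a Jordan block.  The matrix
W = S P2^-1 P1, on the other hand, depends on xi, so xi can be chosen to make
the first subsystem as close to normal as possible.  Writing
h = (q1 - p1) t / 2, the flow of the first subsystem is
exp(- (p1 + q1) t / 2) times the determinant-one matrix
W diag(e^h, e^-h) W^-1, whose largest singular value e^u satisfies
sinh u = sqrt(1 + (ab + cd)^2) sinh h, where a, b, c, d are the entries of W.
The inner product ab + cd of its columns is a quadratic polynomial in xi, and K21 is exactly the
minimum of 1 + (ab + cd)^2 over xi ([shear_condition_number]).  So in the
coordinates y the norms of the two flows are at most exp(- decay t) and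
exp(growth s), the two sides of the equation that defines tau
([diag_flow_le], [jordan_flow_le]).

The function decay is convex and unbounded on [0, +oo[ and vanishes at 0, so
it takes each positive value exactly once and increases strictly from there on
([decay_lt], [decay_unique]).  Therefore a dwell time t >= tau in mode 1
followed by a dwell time s <= eta in mode 2 multiplies the norm of y by at
most exp(growth s - decay t) <= exp(growth eta - decay tau) = 1, and within a
period the norm cannot exceed a fixed multiple of its value at the start: this
is stability ([tail_le]).  If the dwell times do not converge to (tau, eta),
then infinitely many periods contract by one common factor below 1, and the
norm tends to 0 ([admissible_cvg0]). *)

(** * Norms of plane linear maps *)

Section norms.
Context {R : realType}.
Implicit Types (a b c d x y t u h E L : R) (v : 'cV[R]_2).

(** The quadratic form L |v|^2 - |A v|^2 is positive semidefinite as soon as its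
    matrix has nonnegative trace and determinant; these are the two
    hypotheses, the determinant being the characteristic polynomial of A^T A
    at L. *)
Lemma quadratic_image_le a b c d L x y :
  a ^+ 2 + b ^+ 2 + c ^+ 2 + d ^+ 2 <= 2 * L ->
  0 <= L ^+ 2 - (a ^+ 2 + b ^+ 2 + c ^+ 2 + d ^+ 2) * L + (a * d - b * c) ^+ 2 ->
  (a * x + b * y) ^+ 2 + (c * x + d * y) ^+ 2 <= L * (x ^+ 2 + y ^+ 2).
Proof.
move=> trL detL.
set g := L - a ^+ 2 - c ^+ 2; set k := L - b ^+ 2 - d ^+ 2.
set f := a * b + c * d.
have gk : 0 <= g + k by rewrite /g /k; lra.
have gkf : 0 <= g * k - f ^+ 2.
  by move: detL; congr (_ <= _); rewrite /g /k /f; ring.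
have f2 := sqr_ge0 f.
have g0 : 0 <= g by rewrite leNgt; apply/negP => ?; nra.
have k0 : 0 <= k by rewrite leNgt; apply/negP => ?; nra.
rewrite -subr_ge0.
have -> : L * (x ^+ 2 + y ^+ 2) - ((a * x + b * y) ^+ 2 + (c * x + d * y) ^+ 2)
    = g * x ^+ 2 - 2 * f * x * y + k * y ^+ 2 by rewrite /g /k /f; ring.
have [gE|gN] := eqVneq g 0.
  have -> : f = 0.
    by apply/eqP; rewrite -sqrf_eq0 eq_le f2 andbT; move: gkf; rewrite gE; lra.
  by rewrite gE mul0r mulr0 !mul0r subrr add0r; apply: mulr_ge0 (sqr_ge0 _).
have gp : 0 < g by rewrite lt_neqAle eq_sym gN.
rewrite -(pmulr_rge0 _ gp).
have -> : g * (g * x ^+ 2 - 2 * f * x * y + k * y ^+ 2) =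
  (g * x - f * y) ^+ 2 + (g * k - f ^+ 2) * y ^+ 2 by ring.
by apply: addr_ge0; [exact: sqr_ge0 | apply: mulr_ge0 (sqr_ge0 _)].
Qed.

(** When the determinant is 1 or -1 the squared singular values are L and 1 / L,
    so the Frobenius norm alone determines the operator norm. *)
Lemma unimodular_image_le a b c d L x y :
  (a * d - b * c) ^+ 2 = 1 -> 1 <= L ->
  a ^+ 2 + b ^+ 2 + c ^+ 2 + d ^+ 2 = L + L^-1 ->
  (a * x + b * y) ^+ 2 + (c * x + d * y) ^+ 2 <= L * (x ^+ 2 + y ^+ 2).
Proof.
move=> det1 L1 trL; have L0 : L != 0 by rewrite gt_eqF //; lra.
apply: quadratic_image_le; rewrite trL ?det1.
  have : L^-1 <= 1 by rewrite invf_le1 //; lra.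
  lra.
suff -> : L ^+ 2 - (L + L^-1) * L + 1 = 0 by [].
by field.
Qed.

(** For the matrix W with entries a, b, c, d, the vectors in the conclusion are
    W diag(E, E^-1) W^-1 v and v for v = W (x, y).  The trace identity measures
    the failure of W diag(1, -1) W^-1 to be orthogonal by ab + cd, the inner
    product of the columns of W. *)
Lemma conj_diag_image_le a b c d E L x y :
  (a * d - b * c) ^+ 2 = 1 -> E != 0 -> 1 <= L ->
  L + L^-1 = 2 + (1 + (a * b + c * d) ^+ 2) * (E - E^-1) ^+ 2 ->
  (a * (E * x) + b * (E^-1 * y)) ^+ 2 + (c * (E * x) + d * (E^-1 * y)) ^+ 2
    <= L * ((a * x + b * y) ^+ 2 + (c * x + d * y) ^+ 2).
Proof.
set e := a * d - b * c; move=> det1 E0 L1 LE.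
have e0 : e != 0 by rewrite -sqrf_eq0 det1 oner_eq0.
have EE : E * E^-1 = 1 by rewrite divff.
set F := E^-1 in LE EE *.
(* The four coefficients are the entries of W diag(E, F) W^-1, F = E^-1. *)
have /= := @unimodular_image_le (e^-1 * (a * d * E - b * c * F))
  (e^-1 * (a * b * (F - E))) (e^-1 * (c * d * (E - F)))
  (e^-1 * (a * d * F - b * c * E)) L (a * x + b * y) (c * x + d * y).
have -> : e^-1 * (a * d * E - b * c * F) * (a * x + b * y) +
  e^-1 * (a * b * (F - E)) * (c * x + d * y) = a * (E * x) + b * (F * y).
  by apply: (mulfI e0); rewrite /e; field.
have -> : e^-1 * (c * d * (E - F)) * (a * x + b * y) +
  e^-1 * (a * d * F - b * c * E) * (c * x + d * y) = c * (E * x) + d * (F * y).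
  by apply: (mulfI e0); rewrite /e; field.
apply=> //.
  have -> : e^-1 * (a * d * E - b * c * F) * (e^-1 * (a * d * F - b * c * E)) -
    e^-1 * (a * b * (F - E)) * (e^-1 * (c * d * (E - F))) =
    (e ^+ 2)^-1 * (e ^+ 2 * (E * F)) by rewrite /e; field.
  by rewrite det1 EE invr1 !mulr1 expr1n.
rewrite LE !exprMn exprVn det1 invr1 !mul1r.
transitivity (2 * e ^+ 2 * (E * F) +
  (e ^+ 2 + (a * b + c * d) ^+ 2) * (E - F) ^+ 2); last first.
  by rewrite det1 EE !mulr1.
by rewrite /e; ring.
Qed.

(** The singular values e^u, e^-u of the shear by t satisfy
    e^2u + e^-2u = 2 + t^2, that is sinh u = t / 2. *)
Lemma theta_arsinh t : 0 <= t -> theta t = expR (arsinh (t / 2)).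
Proof.
move=> t0; rewrite thetaE // /arsinh.
set s := Num.sqrt (1 + t ^+ 2 / 4).
have s2 : s ^+ 2 = 1 + t ^+ 2 / 4.
  by rewrite sqr_sqrtr // addr_ge0 // divr_ge0 ?sqr_ge0.
have s0 : 0 <= s by exact: sqrtr_ge0.
have -> : Num.sqrt ((t / 2) ^+ 2 + 1) = s.
  by congr Num.sqrt; field.
have sp : 0 < s by rewrite lt_neqAle s0 andbT eq_sym -sqrf_eq0 s2; apply/eqP; nra.
have ts : 0 < t / 2 + s by lra.
rewrite lnK ?posrE //.
have -> : 1 + t ^+ 2 / 2 + t * s = (t / 2 + s) ^+ 2.
  by rewrite sqrrD s2; field.
by rewrite sqrtr_sqr ger0_norm // ltW.
Qed.

Lemma expR_arsinhD y :
  expR (arsinh y) ^+ 2 + (expR (arsinh y) ^+ 2)^-1 = 2 + 4 * y ^+ 2.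
Proof.
rewrite -{3}[y]arsinhK /sinh expRN.
by field; rewrite gt_eqF ?expR_gt0.
Qed.

Lemma arsinh_ge0 y : 0 <= y -> 0 <= arsinh y.
Proof.
move=> y0; apply: ln_ge0.
have : 1 <= Num.sqrt (y ^+ 2 + 1).
  by rewrite -{1}[1]sqrtr1 ler_wsqrtr // lerDr sqr_ge0.
lra.
Qed.

Lemma sinh_ge0 x : 0 <= x -> 0 <= sinh x.
Proof. by move=> x0; rewrite divr_ge0 // subr_ge0 ler_expR; lra. Qed.

Lemma expR_sq_ge1 x : 0 <= x -> 1 <= expR x ^+ 2.
Proof. by move=> x0; rewrite exprn_ege1 // -{1}expR0 ler_expR. Qed.

Lemma enorm_le (r : R) v (w : 'cV[R]_2) : 0 <= r ->
  v 0 0 ^+ 2 + v 1 0 ^+ 2 <= r ^+ 2 * (w 0 0 ^+ 2 + w 1 0 ^+ 2) ->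
  enorm v <= r * enorm w.
Proof.
move=> r0 vw; rewrite !enormE -[r]ger0_norm // -sqrtr_sqr -sqrtrM ?sqr_ge0 //.
exact: ler_wsqrtr.
Qed.

Lemma mulmx_cV2 (B : 'M[R]_2) v i : (B *m v) i 0 = B i 0 * v 0 0 + B i 1 * v 1 0.
Proof.
rewrite mxE big_ord_recl big_ord1; congr (_ + B _ _ * v _ _); exact/val_inj.
Qed.

Lemma det_mx2 (A : 'M[R]_2) : \det A = A 0 0 * A 1 1 - A 0 1 * A 1 0.
Proof.
rewrite (expand_det_row A 0) big_ord_recl big_ord1 /cofactor !det_mx11 !mxE /=.
rewrite expr0 expr1 mul1r mulN1r mulrN.
by congr (_ * A _ _ - A _ _ * A _ _); exact/val_inj.
Qed.

Lemma enorm_mulmx_bounded (B : 'M[R]_2) :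
  exists2 C, 0 < C & forall v, enorm (B *m v) <= C * enorm v.
Proof.
(* F is the squared Frobenius norm; F + 1 is positive and (F + 1)^2 >= F. *)
set F := B 0 0 ^+ 2 + B 0 1 ^+ 2 + B 1 0 ^+ 2 + B 1 1 ^+ 2.
have F0 : 0 <= F by rewrite !addr_ge0 ?sqr_ge0.
exists (F + 1); first by lra.
move=> v; apply: enorm_le => //; first by lra.
rewrite !mulmx_cV2; apply: quadratic_image_le; rewrite -/F; first by nra.
apply: addr_ge0; last exact: sqr_ge0.
nra.
Qed.

End norms.

(** * The decay exponent of the diagonalisable mode *)

Definition cosh (R : realType) (x : R) : R := (expR x + expR (- x)) / 2.

(** Minus the logarithm of the operator norm of the flow of the diagonalisable
    mode; k is the square root of the constant K. *)
Definition decay (R : realType) (p q k t : R) : R :=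
  (p + q) / 2 * t - arsinh (k * sinh ((q - p) / 2 * t)).

Definition decay' (R : realType) (p q k t : R) : R :=
  let h := (q - p) / 2 * t in
  (p + q) / 2 - (q - p) / 2 * (k * cosh h / Num.sqrt ((k * sinh h) ^+ 2 + 1)).

Section decay.
Context {R : realType}.
Implicit Types (x y s t p q k : R).

Lemma sinh0 : sinh 0 = 0 :> R.
Proof. by rewrite /sinh oppr0 subrr mul0r. Qed.

Lemma cosh_ge1 x : 1 <= cosh x.
Proof.
rewrite /cosh expRN; have e0 := expR_gt0 x; set e := expR x in e0 *.
rewrite -subr_ge0.
have -> : (e + e^-1) / 2 - 1 = (e - 1) ^+ 2 / (2 * e) by field; rewrite gt_eqF.
by rewrite divr_ge0 ?sqr_ge0 // mulr_ge0 // ltW.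
Qed.

Lemma sinh_sqr x : sinh x ^+ 2 = cosh x ^+ 2 - 1.
Proof.
by rewrite /sinh /cosh expRN; field; rewrite gt_eqF ?expR_gt0.
Qed.

Lemma sinhDcosh x : sinh x + cosh x = expR x.
Proof. by rewrite /sinh /cosh; field. Qed.

Lemma is_derive_sinh x : is_derive x 1 (@sinh R) (cosh x).
Proof.
rewrite (_ : @sinh R = 2^-1 *: (expR - (expR \o -%R))); last first.
  by apply/funext => y; rewrite !fctE /sinh mulrC.
apply: is_derive_eq.
by rewrite -[LHS]/(2^-1 * _) /cosh mulrN1 opprK mulrC.
Qed.

Lemma is_derive_arsinh x :
  is_derive x 1 (@arsinh R) (Num.sqrt (x ^+ 2 + 1))^-1.
Proof.
have q0 : 0 < x ^+ 2 + 1 by rewrite ltr_wpDl ?sqr_ge0.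
have s0 : 0 < Num.sqrt (x ^+ 2 + 1) by rewrite sqrtr_gt0.
have s2 : Num.sqrt (x ^+ 2 + 1) ^+ 2 = x ^+ 2 + 1 by rewrite sqr_sqrtr // ltW.
set s := Num.sqrt (x ^+ 2 + 1) in s0 s2 *.
have xs : 0 < x + s by nra.
have dq : is_derive x 1 (fun y : R => y ^+ 2 + 1) (2 * x).
  rewrite (_ : (fun y : R => y ^+ 2 + 1) = (id ^+ 2 : R -> R) + cst 1); last first.
    by apply/funext => y; rewrite !fctE.
  apply: is_derive_eq.
  by rewrite addr0 expr1 -[LHS]/((2 * x) * 1) mulr1.
have ds := @is_derive1_comp _ Num.sqrt (fun y : R => y ^+ 2 + 1) x _ _
  (is_derive1_sqrt q0) dq.
have da := is_deriveD (is_derive_id x (1 : R)) ds.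
have dl : is_derive (x + s) 1 (@ln R) (x + s)^-1 by exact: is_derive1_ln.
have := @is_derive1_comp _ (@ln R) (id + (Num.sqrt \o (fun y : R => y ^+ 2 + 1)))
  x _ _ dl da.
move=> /is_derive_eq; apply.
rewrite -/s; field.
by rewrite !gt_eqF.
Qed.

Lemma is_derive_decay p q k t :
  is_derive t 1 (decay p q k) (decay' p q k t).
Proof.
have dh (c : R) : is_derive t 1 ( *%R c) c.
  by apply: (is_derive_eq (is_deriveZ c (is_derive_id t (1 : R)))); exact: mulr1.
have dsh := is_derive1_comp (is_derive_sinh _) (dh ((q - p) / 2)).
have dk := is_deriveZ k dsh.
have du := is_derive1_comp (is_derive_arsinh _) dk.
apply: (is_derive_eq (is_deriveB (dh ((p + q) / 2)) du)).
congr (_ - _); set r := Num.sqrt _.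
by rewrite -[LHS]/(r^-1 * (k * (cosh ((q - p) / 2 * t) * ((q - p) / 2)))); ring.
Qed.

Lemma decay0 p q k : decay p q k 0 = 0.
Proof.
by rewrite /decay !mulr0 sinh0 mulr0 -sinh0 sinhK sinh0 subrr.
Qed.

Lemma cosh_le s t : 0 <= s -> s <= t -> cosh s <= cosh t.
Proof.
move=> s0 st; have := @sinh_ge0 R ((t - s) / 2); have := @sinh_ge0 R ((t + s) / 2).
have -> : cosh t = cosh s + 2 * sinh ((t + s) / 2) * sinh ((t - s) / 2).
  have st1 : expR ((t + s) / 2) * expR ((t - s) / 2) = expR t.
    by rewrite -expRD; congr expR; field.
  have st2 : expR (- ((t + s) / 2)) * expR (- ((t - s) / 2)) = expR (- t).
    by rewrite -expRD; congr expR; field.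
  have st3 : expR ((t + s) / 2) * expR (- ((t - s) / 2)) = expR s.
    by rewrite -expRD; congr expR; field.
  have st4 : expR (- ((t + s) / 2)) * expR ((t - s) / 2) = expR (- s).
    by rewrite -expRD; congr expR; field.
  by rewrite /cosh /sinh -st1 -st2 -st3 -st4; field.
move=> h1 h2; rewrite lerDl; apply: mulr_ge0; last by apply: h2; lra.
by apply: mulr_ge0 => //; apply: h1; lra.
Qed.

(** Convexity of decay.  For k >= 1 the square of k cosh / sqrt(1 + (k sinh)^2) is
    1 + (k^2 - 1) / (1 + (k sinh)^2), which decreases on [0, +oo[. *)
Lemma decay'_le p q k s t : p <= q -> 1 <= k -> 0 <= s -> s <= t ->
  decay' p q k s <= decay' p q k t.
Proof.
move=> pq k1 s0 st; rewrite /decay'.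
set x := (q - p) / 2 * s; set y := (q - p) / 2 * t.
have c0 : 0 <= (q - p) / 2 by lra.
have x0 : 0 <= x by exact: mulr_ge0.
have xy : x <= y by exact: ler_wpM2l.
rewrite lerB // ler_wpM2l //.
have q0 z : 0 < (k * sinh z) ^+ 2 + 1 by rewrite ltr_wpDl ?sqr_ge0.
have r0 z : 0 < Num.sqrt ((k * sinh z) ^+ 2 + 1) by rewrite sqrtr_gt0.
rewrite ler_pdivrMr // mulrAC ler_pdivlMr //.
have cx := cosh_ge1 x; have cy := cosh_le x0 xy.
have kc z w : 0 <= k * cosh z * Num.sqrt w.
  have cz := cosh_ge1 z.
  by apply: mulr_ge0 (sqrtr_ge0 _); apply: mulr_ge0; lra.
rewrite -ler_sqr ?nnegrE //=.
rewrite [leLHS]exprMn [leRHS]exprMn !sqr_sqrtr ?(ltW (q0 _)) // !(exprMn _ k) !sinh_sqr.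
have : cosh x ^+ 2 <= cosh y ^+ 2 by rewrite ler_sqr ?nnegrE //; lra.
have : 1 <= k ^+ 2 by rewrite exprn_ege1.
set K := k ^+ 2; set X := cosh x ^+ 2; set Y := cosh y ^+ 2 => K1 XY.
rewrite -subr_ge0.
have -> : K * X * (K * (Y - 1) + 1) - K * Y * (K * (X - 1) + 1) =
  K * ((K - 1) * (Y - X)) by ring.
rewrite !mulr_ge0 //; lra.
Qed.

Lemma continuous_decay p q k : continuous (decay p q k).
Proof.
move=> t; apply/differentiable_continuous/derivable1_diffP.
by have [] := is_derive_decay p q k t.
Qed.

(** By the mean value theorem on [0, s], decay 0 = 0 < decay s gives a point
    before s where the derivative is positive; by convexity the derivative
    stays positive between s and t.  Positivity at s cannot be dropped: decay
    may decrease near 0 when k is large. *)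
Lemma decay_lt p q k s t : p <= q -> 1 <= k -> 0 < s -> s < t ->
  0 < decay p q k s -> decay p q k s < decay p q k t.
Proof.
move=> pq k1 s0 st ds.
have cont (x y : R) : {within `[x, y], continuous (decay p q k)}.
  exact/continuous_subspaceT/continuous_decay.
have [x xI xE] := MVT s0 (fun x _ => is_derive_decay p q k x) (cont _ _).
have [y yI yE] := MVT st (fun x _ => is_derive_decay p q k x) (cont _ _).
move: xI yI; rewrite !in_itv /= => /andP[x0 xs] /andP[sy yt].
rewrite decay0 !subr0 in xE.
have dx : 0 < decay' p q k x by rewrite -(pmulr_lgt0 _ s0) -xE.
have dy : decay' p q k x <= decay' p q k y by apply: decay'_le => //; lra.
rewrite -subr_gt0 yE mulr_gt0 //; lra.
Qed.

(** Since 1 + (k sinh h)^2 <= (k cosh h)^2, arsinh (k sinh h) is at most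
    ln (k e^h). *)
Lemma decay_ge p q k t : p <= q -> 1 <= k -> 0 <= t ->
  p * t - ln k <= decay p q k t.
Proof.
move=> pq k1 t0; rewrite /decay; set h := (q - p) / 2 * t.
have k0 : 0 < k by lra.
have h0 : 0 <= h by rewrite mulr_ge0 //; lra.
suff : arsinh (k * sinh h) <= ln k + h.
  have -> : (p + q) / 2 * t = p * t + h by rewrite /h; field.
  lra.
have sh := sinh_ge0 h0; have ch := cosh_ge1 h.
have ksh : 0 <= k * sinh h by rewrite mulr_ge0 // ltW.
have rk : Num.sqrt ((k * sinh h) ^+ 2 + 1) <= k * cosh h.
  rewrite -[leRHS]ger0_norm; last by apply: mulr_ge0; lra.
  rewrite -sqrtr_sqr ler_wsqrtr // !(exprMn _ k) sinh_sqr.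
  have : 1 <= k ^+ 2 by rewrite exprn_ege1.
  lra.
have r0 : 0 < Num.sqrt ((k * sinh h) ^+ 2 + 1).
  by rewrite sqrtr_gt0 ltr_wpDl ?sqr_ge0.
rewrite -[in leRHS](expRK h) -lnM ?posrE ?expR_gt0 //.
rewrite /arsinh ler_ln ?posrE ?mulr_gt0 ?expR_gt0 //; last lra.
by rewrite -sinhDcosh mulrDr; lra.
Qed.

Lemma decay_unique p q k v : 0 < p -> p <= q -> 1 <= k -> 0 < v ->
  exists tau, unique (fun t => 0 < t /\ v = decay p q k t) tau.
Proof.
move=> p0 pq k1 v0.
(* The lower bound p t - ln k of decay reaches v at (v + ln k) / p. *)
have T0 : 0 <= (v + ln k) / p.
  by have l0 := ln_ge0 k1; apply: divr_ge0; lra.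
have vT : v <= decay p q k ((v + ln k) / p).
  apply: le_trans (decay_ge pq k1 T0).
  by rewrite mulrCA divff ?gt_eqF // mulr1; lra.
have := @IVT R (decay p q k) 0 ((v + ln k) / p) v T0.
case.
- exact/continuous_subspaceT/continuous_decay.
- by rewrite decay0 ge_min le_max (ltW v0) vT orbT.
move=> tau; rewrite in_itv /= => /andP[tau0 _] tauE.
have taup : 0 < tau.
  rewrite lt_neqAle tau0 andbT; apply/eqP => tauE0.
  by move: tauE v0; rewrite -tauE0 decay0 => ->; rewrite ltxx.
exists tau; split=> // t [tp tE]; have [tt|tt|//] := ltgtP tau t.
- by have := decay_lt pq k1 taup tt; rewrite tauE -tE ltxx => /(_ v0).
- by have := decay_lt pq k1 tp tt; rewrite tauE -tE ltxx => /(_ v0).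
Qed.

End decay.

(** * Flows of the two modes *)

Section flows.
Context {R : realType}.
Implicit Types (a b l n p q s t : R) (f g : R -> R) (x : R -> 'cV[R]_2).
Implicit Types (B W : 'M[R]_2).

Lemma is_derive_expR_affine l a t :
  is_derive t 1 (fun s => expR (l * (s - a))) (l * expR (l * (t - a))).
Proof.
have dl : is_derive t 1 (fun s => l * (s - a)) l.
  have := is_deriveZ l (is_deriveB (is_derive_id t (1 : R))
    (is_derive_cst a t (1 : R))).
  by move=> /is_derive_eq; apply; rewrite subr0; exact: mulr1.
have := @is_derive1_comp _ expR (fun s => l * (s - a)) t _ _
  (is_derive_expR _) dl.
by move=> /is_derive_eq; apply; rewrite mulrC.
Qed.

(** Differentiability is asked on the open interval only, as a solution of the
    switched system need not be differentiable at a switching time. *)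
Lemma linear_ode_unique f l a b :
  {within `[a, b], continuous f} ->
  (forall t, a < t < b -> is_derive t 1 f (l * f t)) ->
  forall t, a <= t <= b -> f t = expR (l * (t - a)) * f a.
Proof.
move=> fc fd t /andP[at_ tb].
pose g s := expR (- l * (s - a)) * f s.
have gd s : s \in `]a, t[ -> is_derive s 1 g 0.
  rewrite in_itv /= => /andP[as_ st].
  have := is_deriveM (is_derive_expR_affine (- l) a s)
    (fd s (introT andP (conj as_ (lt_le_trans st tb)))).
  move=> /is_derive_eq; apply.
  set e := expR _; rewrite -[LHS]/(e * (l * f s) + f s * (- l * e)).
  ring.
have gc : {within `[a, t], continuous g}.
  have sub : `[a, t] `<=` `[a, b].
    by move=> s /=; rewrite !in_itv /= => /andP[-> /le_trans]; apply.
  have fc' : {within `[a, t], continuous f} := continuous_subspaceW sub fc.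
  have ec : continuous (fun s => expR (- l * (s - a))).
    move=> r; apply/differentiable_continuous/derivable1_diffP.
    by have [] := is_derive_expR_affine (- l) a r.
  move=> s; exact: (cvgM (@continuous_subspaceT _ _ `[a, t] _ ec s)
    (fc' s)).
have [c _] := MVT_segment at_ gd gc.
rewrite mul0r /g subrr mulr0 expR0 mul1r => /eqP; rewrite subr_eq0 => /eqP <-.
by rewrite mulrA -expRD mulNr subrr expR0 mul1r.
Qed.

(** The combination f - (t - a) g solves the scalar equation u' = l u. *)
Lemma jordan_ode_unique f g l a b :
  {within `[a, b], continuous f} -> {within `[a, b], continuous g} ->
  (forall t, a < t < b -> is_derive t 1 f (l * f t + g t)) ->
  (forall t, a < t < b -> is_derive t 1 g (l * g t)) ->
  forall t, a <= t <= b ->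
    f t = expR (l * (t - a)) * (f a + (t - a) * g a) /\
    g t = expR (l * (t - a)) * g a.
Proof.
move=> fc gc fd gd t tab.
have gE := linear_ode_unique gc gd tab; split=> //.
pose u s := f s - (s - a) * g s.
have du s : is_derive s 1 (fun r => r - a) 1.
  have := is_deriveB (is_derive_id s (1 : R)) (is_derive_cst a s (1 : R)).
  by move=> /is_derive_eq; apply; rewrite subr0.
have ud s : a < s < b -> is_derive s 1 u (l * u s).
  move=> sab.
  have := is_deriveB (fd s sab) (is_deriveM (du s) (gd s sab)).
  move=> /is_derive_eq; apply.
  rewrite -[LHS]/(l * f s + g s - ((s - a) * (l * g s) + g s * 1)) /u; ring.
have uc : {within `[a, b], continuous u}.
  have bc : continuous (fun r => r - a).
    move=> r; apply/differentiable_continuous/derivable1_diffP.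
    by have [] := du r.
  move=> s; exact: (cvgB (fc s)
    (cvgM (@continuous_subspaceT _ _ `[a, b] _ bc s) (gc s))).
have := linear_ode_unique uc ud tab.
rewrite /u subrr mul0r subr0 gE => /eqP; rewrite subr_eq => /eqP ->.
by ring.
Qed.

Lemma is_derive_mulmx B x t v i : is_derive t 1 x v ->
  is_derive t 1 (fun s => (B *m x s) i 0) ((B *m v) i 0).
Proof.
move=> [dx xv].
have dj j : is_derive t 1 (fun s => x s j 0) (v j 0).
  split; first exact: (derivable_mxP x t 1).1 dx j 0.
  by rewrite -xv derive_mx // mxE.
have := is_deriveD (is_deriveZ (B i 0) (dj 0)) (is_deriveZ (B i 1) (dj 1)).
rewrite mulmx_cV2; congr (is_derive _ _ _ _).
by apply/funext => s; rewrite mulmx_cV2.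
Qed.

Lemma continuous_mulmx B x i (A : set R) : {within A, continuous x} ->
  {within A, continuous (fun s => (B *m x s) i 0)}.
Proof.
move=> xc s.
apply: (@continuous_comp (subspace A) _ _ x (fun v => (B *m v) i 0)).
  exact: xc.
have -> : (fun v : 'cV[R]_2 => (B *m v) i 0) =
    (fun v => B i 0 * v 0 0 + B i 1 * v 1 0).
  by apply/funext => v; rewrite mulmx_cV2.
by apply: continuousD; apply: continuousM; [exact: cst_continuous
  |exact: coord_continuous|exact: cst_continuous|exact: coord_continuous].
Qed.

(** In the eigenbasis of A the flow is exp(- (p + q) s / 2) diag(e^h, e^-h) with
    s = t - a and h = (q - p) s / 2; the matrix W turns this basis into the
    one in which the norm is measured. *)
Lemma diag_flow_le p q K (A P W : 'M[R]_2) x a b t : p <= q ->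
  P \in unitmx -> A = P *m mx22 (- p) 0 0 (- q) *m invmx P ->
  (\det W) ^+ 2 = 1 ->
  {within `[a, b], continuous x} ->
  (forall s, a < s < b -> is_derive s (1 : R) x (A *m x s)) ->
  K = 1 + (W 0 0 * W 0 1 + W 1 0 * W 1 1) ^+ 2 ->
  a <= t <= b ->
  enorm (W *m invmx P *m x t) <=
    expR (- decay p q (Num.sqrt K) (t - a)) * enorm (W *m invmx P *m x a).
Proof.
move=> pq Pu AE detW xc xd KE tab.
have zd i s : a < s < b -> is_derive s 1 (fun s => (invmx P *m x s) i 0)
    ((mx22 (- p) 0 0 (- q) *m (invmx P *m x s)) i 0).
  move=> /xd /(is_derive_mulmx (invmx P) i) /is_derive_eq; apply.
  by rewrite AE !mulmxA mulVmx // mul1mx.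
have zc i := @continuous_mulmx (invmx P) x i _ xc.
set z := fun s => invmx P *m x s.
have z0E : z t 0 0 = expR (- p * (t - a)) * z a 0 0.
  apply: linear_ode_unique (zc 0) _ _ tab => s /(zd 0) /is_derive_eq; apply.
  by rewrite mulmx_cV2 !mxE /= mul0r addr0.
have z1E : z t 1 0 = expR (- q * (t - a)) * z a 1 0.
  apply: linear_ode_unique (zc 1) _ _ tab => s /(zd 1) /is_derive_eq; apply.
  by rewrite mulmx_cV2 !mxE /= mul0r add0r.
move: tab => /andP[at_ tb].
have K1 : 1 <= K by rewrite KE lerDl sqr_ge0.
set h := (q - p) / 2 * (t - a).
have h0 : 0 <= h by apply: mulr_ge0; lra.
set u := arsinh (Num.sqrt K * sinh h).
have u0 : 0 <= u by apply: arsinh_ge0; apply: mulr_ge0 (sqrtr_ge0 _) (sinh_ge0 h0).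
set m := expR (- ((p + q) / 2 * (t - a))).
have e0E : expR (- p * (t - a)) = m * expR h.
  by rewrite -expRD; congr expR; rewrite /h; field.
have e1E : expR (- q * (t - a)) = m * (expR h)^-1.
  by rewrite -expRN -expRD; congr expR; rewrite /h; field.
rewrite -!(mulmxA W) -/(z t) -/(z a).
have -> : expR (- decay p q (Num.sqrt K) (t - a)) = m * expR u.
  by rewrite -expRD; congr expR; rewrite /decay -/h -/u; ring.
apply: enorm_le; first by rewrite mulr_ge0 // expR_ge0.
rewrite !(mulmx_cV2 W) z0E z1E e0E e1E.
have det1 : (W 0 0 * W 1 1 - W 0 1 * W 1 0) ^+ 2 = 1 by rewrite -det_mx2 detW.
have eh : expR h != 0 by rewrite gt_eqF ?expR_gt0.
have := conj_diag_image_le (z a 0 0) (z a 1 0) det1 eh (expR_sq_ge1 u0).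
rewrite expR_arsinhD exprMn sqr_sqrtr; last lra.
have -> : (expR h - (expR h)^-1) ^+ 2 = 4 * sinh h ^+ 2.
  by rewrite /sinh expRN; field.
rewrite -KE => /(_ ltac:(ring)) le.
have m2 : 0 <= m ^+ 2 by exact: sqr_ge0.
move: (ler_wpM2l m2 le); congr (_ <= _); by ring.
Qed.

(** The flow is e^(n s) times the shear by s = t - a, whose norm is theta s.  Only
    the intertwining relation B A = J B is assumed, since it also holds when
    the usual change of basis is followed by a map commuting with J. *)
Lemma jordan_flow_le n (A B : 'M[R]_2) x a b t :
  B *m A = mx22 n 1 0 n *m B ->
  {within `[a, b], continuous x} ->
  (forall s, a < s < b -> is_derive s (1 : R) x (A *m x s)) ->
  a <= t <= b ->
  enorm (B *m x t) <= expR (n * (t - a) + ln (theta (t - a))) * enorm (B *m x a).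
Proof.
move=> BA xc xd tab.
have yd i s : a < s < b -> is_derive s 1 (fun s => (B *m x s) i 0)
    ((mx22 n 1 0 n *m (B *m x s)) i 0).
  move=> /xd /(is_derive_mulmx B i) /is_derive_eq; apply.
  by rewrite !mulmxA BA.
have yc i := @continuous_mulmx B x i _ xc.
have [y0E y1E] : (B *m x t) 0 0 =
    expR (n * (t - a)) * ((B *m x a) 0 0 + (t - a) * (B *m x a) 1 0) /\
    (B *m x t) 1 0 = expR (n * (t - a)) * (B *m x a) 1 0.
  apply: jordan_ode_unique (yc 0) (yc 1) _ _ _ tab => s.
    move=> /(yd 0) /is_derive_eq; apply.
    by rewrite mulmx_cV2 !mxE /= mul1r.
  move=> /(yd 1) /is_derive_eq; apply.
  by rewrite mulmx_cV2 !mxE /= mul0r add0r.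
move: tab => /andP[at_ tb]; have ta0 : 0 <= t - a by lra.
rewrite theta_arsinh // expRK expRD.
set m := expR (n * (t - a)) in y0E y1E *.
set u := arsinh ((t - a) / 2).
have u0 : 0 <= u by apply: arsinh_ge0; lra.
apply: enorm_le; first by rewrite mulr_ge0 // expR_ge0.
rewrite y0E y1E; set y := B *m x a.
have det1 : (1 * 1 - (t - a) * 0) ^+ 2 = 1 :> R by ring.
have trE : 1 ^+ 2 + (t - a) ^+ 2 + 0 ^+ 2 + 1 ^+ 2 = expR u ^+ 2 + (expR u ^+ 2)^-1.
  by rewrite expR_arsinhD; field.
have le := unimodular_image_le (y 0 0) (y 1 0) det1 (expR_sq_ge1 u0) trE.
have m2 : 0 <= m ^+ 2 by exact: sqr_ge0.
move: (ler_wpM2l m2 le); congr (_ <= _); by ring.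
Qed.

End flows.

(** * The optimal shear *)

Section shear.
Context {R : realType}.

(** As a polynomial in xi, the inner product ab + cd of the sheared matrix has
    leading coefficient e = cd and discriminant 1 - 4 e^2.  If 2 |e| <= 1 it has
    a root, and K21 = 1; otherwise its least absolute value is
    (r - 1 / r) / 2 with r = 2 |e|, and 1 + ((r - 1 / r) / 2)^2 =
    ((r + 1 / r) / 2)^2. *)
Lemma shear_condition_number (M : 'M[R]_2) : (\det M) ^+ 2 = 1 ->
  exists xi : R, let W := mx22 1 xi 0 1 *m M in
    (\det W) ^+ 2 = 1 /\
    K21 M = 1 + (W 0 0 * W 0 1 + W 1 0 * W 1 1) ^+ 2.
Proof.
move=> detM.
have WE xi : let W := mx22 1 xi 0 1 *m M in
    (\det W) ^+ 2 = 1 /\ (W 0 0 * W 0 1 + W 1 0 * W 1 1 =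
    M 1 0 * M 1 1 * xi ^+ 2 + (M 0 0 * M 1 1 + M 0 1 * M 1 0) * xi +
    (M 0 0 * M 0 1 + M 1 0 * M 1 1)).
  split; first by rewrite det_mulmx det_mx2 !mxE /= mulr0 subr0 !mul1r.
  have lift1 : lift ord0 ord0 = 1 :> 'I_2 by exact/val_inj.
  rewrite !mxE !big_ord_recl !big_ord0 !mxE /= !lift1.
  ring.
suff [xi xiE] : exists xi, K21 M = 1 + (M 1 0 * M 1 1 * xi ^+ 2 +
    (M 0 0 * M 1 1 + M 0 1 * M 1 0) * xi +
    (M 0 0 * M 0 1 + M 1 0 * M 1 1)) ^+ 2.
  by exists xi; have /= [detE ->] := WE xi.
rewrite /K21; move: detM; rewrite det_mx2.
set a := M 0 0; set b := M 0 1; set c := M 1 0; set d := M 1 1 => detM.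
set e := c * d; set g := a * d + b * c.
have gE : g ^+ 2 = 1 + 4 * (a * b) * e.
  transitivity ((a * d - b * c) ^+ 2 + 4 * (a * b) * e); last by rewrite detM.
  by rewrite /g /e; ring.
have [e0|eN0] := eqVneq e 0.
  (* The polynomial is g xi + ab, and g = 1 / g. *)
  exists (- (g * (a * b))).
  rewrite e0 normr0 mulr0 max_r ?ler01 // invr1 mul0r addr0 add0r.
  have -> : g * - (g * (a * b)) + a * b = (1 - g ^+ 2) * (a * b) by ring.
  by rewrite gE e0; field.
have [le1|gt1] := leP (2 * `|e|) 1.
  have D0 : 0 <= 1 - 4 * e ^+ 2.
    by rewrite -real_normK ?num_real //; have := normr_ge0 e; nra.
  exists ((- g + Num.sqrt (1 - 4 * e ^+ 2)) / (2 * e)).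
  have sD := sqr_sqrtr D0; set s := Num.sqrt _ in sD *.
  have -> : e * ((- g + s) / (2 * e)) ^+ 2 + g * ((- g + s) / (2 * e)) +
     (a * b + e) = (s ^+ 2 - g ^+ 2 + 4 * e * (a * b + e)) / (4 * e).
    by field.
  by rewrite sD gE; field.
(* The extremum of the polynomial. *)
exists (- g / (2 * e)).
have -> : e * (- g / (2 * e)) ^+ 2 + g * (- g / (2 * e)) + (a * b + e) =
  (4 * e * (a * b + e) - g ^+ 2) / (4 * e) by field.
have r0 : `|e| != 0 by rewrite normr_eq0.
have -> : ((2 * `|e|)^-1 + 2 * `|e|) ^+ 2 / 4 =
  (1 + 4 * `|e| ^+ 2) ^+ 2 / (16 * `|e| ^+ 2) by field.
rewrite real_normK ?num_real // gE.
by field.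
Qed.

End shear.

(** * The growth exponent of the Jordan mode *)

Definition growth (R : realType) (n s : R) : R := n * s + ln (theta s).

Section growth.
Context {R : realType}.
Implicit Types n s t : R.

Lemma growth_lt n s t : 0 <= n -> 0 <= s -> s < t -> growth n s < growth n t.
Proof.
move=> n0 s0 st; rewrite /growth !theta_arsinh ?expRK; try lra.
rewrite ler_ltD // ?ler_wpM2l //; first exact: ltW.
have r0 (x : R) : 0 < Num.sqrt (x ^+ 2 + 1).
  by rewrite sqrtr_gt0 ltr_wpDl ?sqr_ge0.
have rs := r0 (s / 2); have rt := r0 (t / 2).
rewrite /arsinh ltr_ln ?posrE; try lra.
apply: ltr_leD; first lra.
by apply: ler_wsqrtr; nra.
Qed.

Lemma growth_gt0 n s : 0 <= n -> 0 < s -> 0 < growth n s.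
Proof.
move=> n0 s0; have := growth_lt n0 (lexx 0) s0.
rewrite [X in X < _ -> _](_ : _ = 0) // /growth theta_arsinh // expRK.
by rewrite mulr0 mul0r add0r /arsinh expr0n /= !add0r sqrtr1 ln1.
Qed.

End growth.

(** * Switching signals *)

Section signals.
Context {R : realType}.
Implicit Types (sigma : R -> mode) (d : nat -> R) (x : R -> 'cV[R]_2).

Lemma switching_times_le sigma d j k : switching_times sigma d ->
  (j <= k)%N -> d j <= d k.
Proof.
move=> [_ dS _ _ _]; elim: k => [|k IH]; first by rewrite leqn0 => /eqP ->.
by rewrite leq_eqVlt ltnS => /predU1P[->//|/IH jk]; exact: le_trans (ltW (dS k)).
Qed.

Lemma sigma_even_odd sigma d k : switching_times sigma d -> sigma 0 = mode1 ->
  sigma (d k.*2) = mode1 /\ sigma (d k.*2.+1) = mode2.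
Proof.
move=> [d0 _ _ _ alt] s0.
suff e : sigma (d k.*2) = mode1.
  by split=> //; have := alt k.*2; rewrite e; case: (sigma _).
elim: k => [|k IH]; first by rewrite double0 d0.
have := alt k.*2.+1; have := alt k.*2; rewrite IH doubleS.
by case: (sigma (d k.*2.+1)) => // _; case: (sigma (d k.*2.+2)).
Qed.

Lemma switched_solution_piece sigma d (A1 A2 : 'M[R]_2) x k :
  switching_times sigma d -> switched_solution A1 A2 sigma x ->
  {within `[d k, d k.+1], continuous x} /\
  forall t, d k < t < d k.+1 ->
    is_derive t (1 : R) x (subsystem A1 A2 (sigma (d k)) *m x t).
Proof.
move=> sw [xc xd]; have dk := switching_times_le sw (leq0n k).
have [d0 _ _ cst _] := sw; rewrite d0 in dk; split.
  apply: continuous_subspaceW xc => s /=.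
  by rewrite !in_itv /= andbT => /andP[/(le_trans dk)].
move=> t /andP[kt tk].
have E s : d k < s < d k.+1 -> sigma s = sigma (d k).
  by move=> /andP[ks sk]; apply: cst; rewrite (ltW ks).
rewrite -(E t) ?kt //; apply: xd; first exact: le_lt_trans kt.
have : t \in `]d k, d k.+1[ by rewrite in_itv /= kt.
move=> /near_in_itvoo; apply: filterS => s; rewrite in_itv /= => sk.
by rewrite !E ?kt.
Qed.

(** The times d 0, d 2, d 4, ... are the starts of the periods; they exhaust
    [0, +oo[. *)
Lemma unbounded_times d k t : d n @[n --> \oo] --> +oo -> d k.*2 <= t ->
  exists2 j, (k <= j)%N & d j.*2 <= t < d j.+1.*2.
Proof.
move=> dy kt; apply: contrapT => no.
have all_le j : (k <= j)%N -> d j.*2 <= t.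
  elim: j => [|j IH]; first by rewrite leqn0 => /eqP <-.
  rewrite leq_eqVlt ltnS => /predU1P[<-//|kj].
  rewrite leNgt; apply/negP => tj; apply: no; exists j => //.
  by rewrite IH.
have /cvgryPgt/(_ t)[N _ NP] := dy.
have := all_le (maxn N k) (leq_maxr _ _); rewrite leNgt NP //=.
by rewrite -addnn (leq_trans (leq_maxl N k)) ?leq_addr.
Qed.

End signals.

(** * Contraction over the periods *)

Section contraction.
Context {R : realType}.
Implicit Types (tau eta c rho : R) (d V : nat -> R) (v f g : R -> R).

(** All that the contraction argument needs of the system: v stands for the norm of a
    solution, g and f for the exponents of the two modes. *)
Definition period_bounds f g d v := forall k,
  (forall t, d k.*2 <= t <= d k.*2.+1 ->
    v t <= expR (- g (t - d k.*2)) * v (d k.*2)) /\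
  (forall t, d k.*2.+1 <= t <= d k.*2.+2 ->
    v t <= expR (f (t - d k.*2.+1)) * v (d k.*2.+1)).

Lemma cvg0_frequent_contraction V rho : 0 <= rho < 1 -> (forall k, 0 <= V k) ->
  (forall k, V k.+1 <= V k) ->
  (forall N, exists2 k, (N <= k)%N & V k.+1 <= rho * V k) ->
  V k @[k --> \oo] --> 0.
Proof.
move=> /andP[rho0 rho1] V0 Vdecr Vrho.
have Vle j k : (j <= k)%N -> V k <= V j.
  elim: k => [|k IH]; first by rewrite leqn0 => /eqP ->.
  by rewrite leq_eqVlt ltnS => /predU1P[->//|/IH]; exact: le_trans.
have geo n : exists k, V k <= rho ^+ n * V 0.
  elim: n => [|n [k kE]]; first by exists 0; rewrite expr0 mul1r.
  have [m km mE] := Vrho k; exists m.+1; apply: (le_trans mE).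
  by rewrite exprS -mulrA ler_wpM2l // (le_trans (Vle _ _ km)).
have rho_cvg : rho ^+ n * V 0 @[n --> \oo] --> 0.
  rewrite -[X in _ --> X](mul0r (V 0)); apply: cvgMl.
  by apply: cvg_expr; rewrite ger0_norm.
apply/cvgrPdist_lt => e e0.
have /cvgrPdist_lt/(_ e e0)[n _ nP] := rho_cvg.
have [k kE] := geo n; exists k => // j /= kj.
have := nP n (leqnn n); rewrite !sub0r !normrN /=.
rewrite !ger0_norm ?mulr_ge0 ?exprn_ge0 //.
by apply: le_lt_trans; apply: le_trans kE; exact: Vle.
Qed.

(** Since t k >= tau and s k <= eta, failing to converge to (tau, eta) means
    staying above tau, or below eta, by a fixed amount infinitely often. *)
Lemma not_cvg_pair_gap tau eta (t s : nat -> R) :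
  (forall k, tau <= t k) -> (forall k, s k <= eta) ->
  ~ ((t k, s k) @[k --> \oo] --> (tau, eta)) ->
  exists2 e, 0 < e & forall N, exists2 k, (N <= k)%N &
    tau + e <= t k \/ s k <= eta - e.
Proof.
move=> tt se ncvg; apply: contrapT => no; apply: ncvg.
have close e : 0 < e -> exists N, forall k, (N <= k)%N ->
    t k < tau + e /\ eta - e < s k.
  move=> e0; apply: contrapT => noN; apply: no; exists e => // N.
  apply: contrapT => nok; apply: noN; exists N => k Nk.
  by split; rewrite ltNge; apply/negP => h; apply: nok; exists k; [|left| |right].
have t_cvg : t k @[k --> \oo] --> tau.
  apply/cvgrPdist_lt => e /close[N NP]; exists N => // k /NP[te _].
  by rewrite distrC ger0_norm ?subr_ge0 //; lra.
have s_cvg : s k @[k --> \oo] --> eta.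
  apply/cvgrPdist_lt => e /close[N NP]; exists N => // k /NP[_ es].
  by rewrite ger0_norm ?subr_ge0 //; lra.
exact: cvg_pair t_cvg s_cvg.
Qed.

Section bounds.
Variables (tau eta c : R) (f g v : R -> R) (d : nat -> R) (sigma : R -> mode).
Hypothesis adm : admissible tau eta sigma d.
Hypothesis v_ge0 : forall t : R, 0 <= v t.
Hypothesis bounds : period_bounds f g d v.
Hypothesis f_incr : forall s t : R, 0 <= s -> s < t -> f s < f t.
Hypothesis g_incr : forall s t : R, tau <= s -> s < t -> g s < g t.
Hypothesis fg : f eta = g tau.
Hypothesis g_ge : forall t : R, 0 <= t -> - c <= g t.
Hypothesis c_ge0 : 0 <= c.

Let f_le (s t : R) : 0 <= s -> s <= t -> f s <= f t.
Proof. by move=> s0; rewrite le_eqVlt => /predU1P[->//|/f_incr h]; apply/ltW/h. Qed.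

Let g_le (s t : R) : tau <= s -> s <= t -> g s <= g t.
Proof. by move=> s0; rewrite le_eqVlt => /predU1P[->//|/g_incr h]; apply/ltW/h. Qed.

Let d_lt k : d k < d k.+1.
Proof. by have [[_ + _ _ _] _ _] := adm; apply. Qed.

Lemma mid_period_le k t : d k.*2.+1 <= t <= d k.*2.+2 ->
  v t <= expR (f (t - d k.*2.+1) - g (dwell1 d k)) * v (d k.*2).
Proof.
move=> td; have [mode1_le mode2_le] := bounds k.
apply: (le_trans (mode2_le t td)); rewrite expRD -mulrA.
rewrite ler_wpM2l ?expR_ge0 //; apply: mode1_le.
by rewrite lexx (ltW (d_lt _)).
Qed.

Lemma period_le k :
  v (d k.+1.*2) <= expR (f (dwell2 d k) - g (dwell1 d k)) * v (d k.*2).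
Proof. by apply: mid_period_le; rewrite lexx (ltW (d_lt _)). Qed.

(** While mode 1 is active v grows by e^c at most; in mode 2 the growth is already
    compensated by the decay over the whole dwell time in mode 1. *)
Lemma within_period_le k t : d k.*2 <= t <= d k.*2.+2 ->
  v t <= expR c * v (d k.*2).
Proof.
move=> /andP[kt tk]; have [_ _ /(_ k)[tau_le le_eta]] := adm.
have [tm|mt] := leP t (d k.*2.+1).
  apply: le_trans ((bounds k).1 t _) _; first by rewrite kt.
  rewrite ler_wpM2r // ler_expR lerNl g_ge //; lra.
apply: le_trans (@mid_period_le k t _) _; first by rewrite (ltW mt).
rewrite ler_wpM2r // ler_expR.
apply: le_trans c_ge0; rewrite subr_le0.
apply: le_trans (g_le (lexx tau) tau_le); rewrite -fg.
by apply: f_le; [|apply: le_trans le_eta; rewrite /dwell2]; lra.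
Qed.

Lemma period_decr k : v (d k.+1.*2) <= v (d k.*2).
Proof.
have [_ _ /(_ k)[tau_le le_eta]] := adm; have dk := d_lt k.*2.+1.
apply: (le_trans (period_le k)); rewrite ler_piMl // -expR0 ler_expR subr_le0.
apply: le_trans (g_le (lexx tau) tau_le); rewrite -fg; apply: f_le => //.
by rewrite subr_ge0 ltW.
Qed.

Lemma tail_le k t : d k.*2 <= t -> v t <= expR c * v (d k.*2).
Proof.
have [[_ _ dy _ _] _ _] := adm => /(unbounded_times dy)[j kj /andP[jt tj]].
apply: le_trans (@within_period_le j t _) _; first by rewrite jt ltW.
rewrite ler_wpM2l ?expR_ge0 //.
elim: j kj {jt tj} => [|j IH]; first by rewrite leqn0 => /eqP ->.
rewrite leq_eqVlt ltnS => /predU1P[->//|/IH].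
exact/le_trans/period_decr.
Qed.

(** A period whose dwell times stay away from (tau, eta) contracts v by e^-m, where
    m is the smaller of the two losses in exponent: a longer stay in mode 1 or
    a shorter one in mode 2. *)
Lemma admissible_cvg0 : 0 < eta ->
  ~ ((dwell1 d k, dwell2 d k) @[k --> \oo] --> (tau, eta)) ->
  v t @[t --> +oo] --> 0.
Proof.
move=> eta0 ncvg; have [_ _ dw] := adm.
have [e0 e00 gap] := not_cvg_pair_gap (fun k => (dw k).1) (fun k => (dw k).2) ncvg.
(* The minimum with eta keeps eta - e in the domain of monotonicity of f. *)
pose e := Num.min e0 eta.
have e_gt0 : 0 < e by rewrite lt_min e00.
have [ee0 eeta] : e <= e0 /\ e <= eta by rewrite /e !ge_min !lexx orbT.
pose m := Num.min (g (tau + e) - g tau) (f eta - f (eta - e)).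
have m0 : 0 < m.
  by rewrite lt_min !subr_gt0 g_incr ?f_incr; lra.
have frequent N : exists2 k, (N <= k)%N &
    v (d k.+1.*2) <= expR (- m) * v (d k.*2).
  have [k Nk far] := gap N; exists k => //.
  have dk := d_lt k.*2.+1; have [tau_le le_eta] := dw k.
  apply: (le_trans (period_le k)); rewrite ler_wpM2r // ler_expR.
  have s0 : 0 <= dwell2 d k by rewrite /dwell2; lra.
  have fs := f_le s0 le_eta; have fgE := fg; have gt := g_le (lexx tau) tau_le.
  have [m1 m2] : m <= g (tau + e) - g tau /\ m <= f eta - f (eta - e).
    by rewrite /m !ge_min !lexx orbT.
  case: far => far.
    have : g (tau + e) <= g (dwell1 d k) by apply: g_le => //; lra.
    lra.
  have : f (dwell2 d k) <= f (eta - e) by apply: f_le => //; lra.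
  lra.
have V0 : v (d k.*2) @[k --> \oo] --> 0.
  apply: (cvg0_frequent_contraction (rho := expR (- m))) => //.
  - by rewrite expR_ge0 -expR0 ltr_expR; lra.
  - exact: period_decr.
apply/cvgrPdist_lt => e1 e10.
have [k _ kP] := ((cvgrPdist_lt _ _).1 V0) (e1 / expR c) (divr_gt0 e10 (expR_gt0 _)).
have := kP k (leqnn k); rewrite sub0r normrN ger0_norm // ltr_pdivlMr ?expR_gt0 //.
move=> small; exists (d k.*2); split; first exact: num_real.
move=> t /ltW dt; rewrite sub0r normrN ger0_norm //.
by apply: le_lt_trans small; rewrite mulrC; exact: tail_le.
Qed.

End bounds.
End contraction.

(** * Back to the switched system *)

Section system.
Context {R : realType}.
Implicit Types (p q n tau eta : R) (A B P : 'M[R]_2).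

Lemma enorm_ge0 (v : 'cV[R]_2) : 0 <= enorm v.
Proof. exact: sqrtr_ge0. Qed.

Lemma solution_period_bounds p q n K (A1 A2 P B : 'M[R]_2) sigma d x :
  p <= q -> P \in unitmx -> A1 = P *m mx22 (- p) 0 0 (- q) *m invmx P ->
  B *m A2 = mx22 n 1 0 n *m B ->
  let W := B *m P in (\det W) ^+ 2 = 1 ->
  K = 1 + (W 0 0 * W 0 1 + W 1 0 * W 1 1) ^+ 2 ->
  switching_times sigma d -> sigma 0 = mode1 ->
  switched_solution A1 A2 sigma x ->
  period_bounds (growth n) (decay p q (Num.sqrt K)) d
    (fun t => enorm (B *m x t)).
Proof.
move=> pq Pu A1E BA W detW KE sw s0 sol k.
have [s1 s2] := sigma_even_odd k sw s0.
have [c1 d1] := switched_solution_piece k.*2 sw sol.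
have [c2 d2] := switched_solution_piece k.*2.+1 sw sol.
rewrite s1 /= in d1; rewrite s2 /= in d2; split=> t td.
  have := diag_flow_le pq Pu A1E detW c1 d1 KE td.
  by rewrite /W -!(mulmxA B) mulmxV // !mul1mx.
exact: jordan_flow_le BA c2 d2 td.
Qed.

(** An invertible change of coordinates alters norms by bounded factors only, so it
    affects neither stability nor, in the next lemma, convergence to 0. *)
Lemma stable_of_bound (A1 A2 B : 'M[R]_2) sigma C : B \in unitmx -> 0 < C ->
  (forall x, switched_solution A1 A2 sigma x -> forall t, 0 <= t ->
     enorm (B *m x t) <= C * enorm (B *m x 0)) ->
  stable A1 A2 sigma.
Proof.
move=> Bu C0 bound e e0.
have [C1 C10 le1] := enorm_mulmx_bounded (invmx B).
have [C2 C20 le2] := enorm_mulmx_bounded B.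
have CC : 0 < C1 * (C * C2) by rewrite !mulr_gt0.
exists (e / (C1 * (C * C2))); first exact: divr_gt0.
move=> x sol; rewrite ltr_pdivlMr // mulrC => small t t0.
apply: le_lt_trans small; rewrite -[x t](mulKmx Bu).
apply: (le_trans (le1 _)); rewrite -!mulrA ler_pM2l //.
apply: (le_trans (bound x sol t (ltW t0))); rewrite ler_pM2l //.
Qed.

Lemma cvg0_of_mulmx (B : 'M[R]_2) (x : R -> 'cV[R]_2) : B \in unitmx ->
  enorm (B *m x t) @[t --> +oo] --> 0 -> enorm (x t) @[t --> +oo] --> 0.
Proof.
move=> Bu xc; have [C C0 le1] := enorm_mulmx_bounded (invmx B).
have Cxc : C * enorm (B *m x t) @[t --> +oo] --> 0.
  by rewrite -(mulr0 C); apply: cvgMr.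
apply: (squeeze_cvgr _ (cvg_cst 0) Cxc); near=> t.
by rewrite enorm_ge0 -{1}[x t](mulKmx Bu) le1.
Unshelve. all: by end_near. Qed.

End system.

Theorem theorem11p2 (R : realType) (p1 q1 n2 eta : R) (A1 A2 P1 P2 : 'M[R]_2)
    (p1_gt0 : 0 < p1) (le_p1_q1 : p1 <= q1) (n2_ge0 : 0 <= n2)
    (eta_gt0 : 0 < eta)
    (P1_unit : P1 \in unitmx) (P2_unit : P2 \in unitmx)
    (A1E : A1 = P1 *m mx22 (- p1) 0 0 (- q1) *m invmx P1)
    (A2E : A2 = P2 *m mx22 n2 1 0 n2 *m invmx P2)
    (detM : \det (invmx P2 *m P1) = 1 \/ \det (invmx P2 *m P1) = -1) :
  let K := K21 (invmx P2 *m P1) in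
  exists tau : R,
    [/\ unique (fun t => 0 < t /\ tau21_equation p1 q1 n2 K eta t) tau,
        forall sigma, signalS tau eta sigma -> stable A1 A2 sigma &
        forall sigma, signalS' tau eta sigma ->
          asymptotically_stable A1 A2 sigma].
Proof.
move=> K.
have det2 : (\det (invmx P2 *m P1)) ^+ 2 = 1.
  by case: detM => ->; rewrite ?sqrrN expr1n.
have [xi [detW KE]] := shear_condition_number det2; rewrite -/K in KE.
pose S := mx22 1 xi 0 1; pose B := S *m invmx P2.
have WE : S *m (invmx P2 *m P1) = B *m P1 by rewrite mulmxA.
rewrite WE in detW KE.
have K1 : 1 <= K by rewrite KE lerDl sqr_ge0.
have k1 : 1 <= Num.sqrt K by rewrite -{1}[1]sqrtr1 ler_wsqrtr.
have Bu : B \in unitmx.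
  have : \det (B *m P1) \is a GRing.unit.
    by rewrite unitfE -sqrf_eq0 detW oner_eq0.
  by rewrite det_mulmx unitrM -unitmxE => /andP[].
have BA : B *m A2 = mx22 n2 1 0 n2 *m B.
  (* S is a polynomial in the nilpotent part of the Jordan block. *)
  have SJ : S *m mx22 n2 1 0 n2 = mx22 n2 1 0 n2 *m S.
    apply/matrixP => i j; rewrite !mxE !big_ord_recl !big_ord0 !mxE /=.
    by case: i => -[|[|//]] ?; case: j => -[|[|//]] ? /=; ring.
  by rewrite A2E /B !mulmxA mulmxKV // SJ.
have growth0 := growth_gt0 n2_ge0 eta_gt0.
have [tau tauP] := decay_unique p1_gt0 le_p1_q1 k1 growth0.
have [[tau0 tauE] _] := tauP; exists tau.
have fi (s t : R) : 0 <= s -> s < t -> growth n2 s < growth n2 t by exact: growth_lt.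
have gi (s t : R) : tau <= s -> s < t ->
    decay p1 q1 (Num.sqrt K) s < decay p1 q1 (Num.sqrt K) t.
  move=> ts st; apply: decay_lt => //; first exact: lt_le_trans ts.
  move: ts; rewrite le_eqVlt => /predU1P[<-|ts]; first by rewrite -tauE.
  by apply: lt_trans (decay_lt le_p1_q1 k1 tau0 ts _); rewrite -tauE.
have gl (t : R) : 0 <= t -> - ln (Num.sqrt K) <= decay p1 q1 (Num.sqrt K) t.
  move=> t0; apply: le_trans (decay_ge le_p1_q1 k1 t0).
  by rewrite lerDr mulr_ge0 // ltW.
have bounds sigma d x : admissible tau eta sigma d ->
    switched_solution A1 A2 sigma x ->
    period_bounds (growth n2) (decay p1 q1 (Num.sqrt K)) d
      (fun t => enorm (B *m x t)).
  move=> [sw s0 _].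
  exact: (solution_period_bounds le_p1_q1 P1_unit A1E BA detW KE sw s0).
have st sigma : signalS tau eta sigma -> stable A1 A2 sigma.
  move=> [d adm]; apply: (stable_of_bound Bu (expR_gt0 (ln (Num.sqrt K)))).
  move=> x sol t t0; have [[d0 _ _ _ _] _ _] := adm.
  have dt : d (0.*2)%N <= t by rewrite double0 d0.
  have := tail_le adm (fun t => enorm_ge0 (B *m x t)) (bounds _ _ _ adm sol)
    fi gi tauE gl (ln_ge0 k1) dt.
  by rewrite double0 d0.
split=> // sigma [d adm ncvg]; split; first by apply: st; exists d.
move=> x sol; apply: (cvg0_of_mulmx Bu).
exact: (admissible_cvg0 adm (fun t => enorm_ge0 (B *m x t))
  (bounds _ _ _ adm sol) fi gi tauE gl (ln_ge0 k1) eta_gt0 ncvg).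
Qed.
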